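(* Let $G$ be a non-complete Cayley graph of odd order $n$ whose clique number $\omega$ satisfies $\omega>\frac{n}{3}$. Then $G$ is not of type I, i.e. $\chi''(G)\neq\Delta+1$, where $\Delta$ is the degree of $G$.
   Context: For a finite group $H$ and a subset $S\subseteq H$ with $S=S^{-1}$ and identity $\notin S$, the Cayley graph has vertex set $H$ and edges $\{g,gs\}$ for $g\in H$, $s\in S$; it is $|S|$-regular. A total coloring of a simple graph is an assignment of colors to vertices and edges such that adjacent vertices, adjacent edges, and an edge and its endpoints all receive different colors; $\chi''(G)$ is the minimum number of colors in a total coloring. A graph with maximum degree $\Delta$ is of type I if $\chi''(G)=\Delta+1$. *)

(* Defs.v *)
From mathcomp Require Import all_boot all_fingroup.

Set Implicit Arguments.
Unset Strict Implicit.
Unset Printing Implicit Defensive.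

Record sgraph := SGraph {
  vertex :> finType;
  adj : rel vertex;
  adj_sym : symmetric adj;
  adj_irrefl : irreflexive adj }.

Section SimpleGraph.
Variable G : sgraph.

Definition degree (x : G) : nat := #|[set y | adj x y]|.

Definition max_degree : nat := \max_(x : G) degree x.

Definition clique (A : {set G}) : bool :=
  [forall x in A, forall y in A, (x != y) ==> adj x y].

Definition clique_number : nat := \max_(A : {set G} | clique A) #|A|.

Definition complete : bool := clique [set: G].

Definition edges : {set {set G}} := [set [set x; y] | x in G, y in adj x].

Definition edge : finType := {E : {set G} | E \in edges}.

Definition element : finType := (G + edge)%type.

Definition conflict (a b : element) : bool :=
  match a, b with
  | inl x, inl y => adj x y
  | inl x, inr E => x \in val E
  | inr E, inl x => x \in val E
  | inr E, inr F => (E != F) && (val E :&: val F != set0)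
  end.

Definition total_coloring k (c : {ffun element -> 'I_k}) : bool :=
  [forall a, forall b, conflict a b ==> (c a != c b)].

Definition total_colorable k : bool :=
  [exists c : {ffun element -> 'I_k}, total_coloring c].

Lemma conflict_irrefl : irreflexive conflict.
Proof. by case=> [x|E] /=; rewrite ?adj_irrefl ?eqxx. Qed.

Lemma ex_total_colorable : exists k, total_colorable k.
Proof.
exists #|element|; apply/existsP; exists [ffun a => enum_rank a].
apply/forallP=> a; apply/forallP=> b; apply/implyP=> ab.
rewrite !ffunE (inj_eq enum_rank_inj); apply/eqP=> eq_ab.
by rewrite eq_ab conflict_irrefl in ab.
Qed.

Definition total_chromatic_number : nat := ex_minn ex_total_colorable.

Definition type_I : Prop := total_chromatic_number = max_degree.+1.

End SimpleGraph.

Section CayleyGraph.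
Variables (gT : finGroupType) (S : {set gT}).

Definition cayley_adj : rel gT := fun g h => [exists s in S, h == (g * s)%g].

Lemma cayley_adjE g h : cayley_adj g h = ((g^-1 * h)%g \in S).
Proof.
apply/exists_inP/idP => [[s sS /eqP->]|ghS]; first by rewrite mulKg.
by exists (g^-1 * h)%g => //; rewrite mulKVg.
Qed.

Hypotheses (S_inv : (S^-1)%g = S) (S_1 : 1%g \notin S).

Lemma cayley_adj_sym : symmetric cayley_adj.
Proof. by move=> g h; rewrite !cayley_adjE -{1}S_inv mem_invg invMg invgK. Qed.

Lemma cayley_adj_irrefl : irreflexive cayley_adj.
Proof. by move=> g; rewrite cayley_adjE mulVg (negbTE S_1). Qed.

Definition cayley_graph : sgraph := SGraph cayley_adj_sym cayley_adj_irrefl.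

End CayleyGraph.

(* Main.v *)
Require Import Defs.
From mathcomp Require Import all_boot all_fingroup.

(** In a total coloring of a [k]-regular graph with [k.+1] colors, every color
    is seen at every vertex. Hence each color class consists of an independent
    set of vertices and a perfect matching of the remaining vertices, so for
    odd order every color is used on an odd number of vertices. For a Cayley
    graph, a clique [A] and an independent set [B] satisfy [#|A| * #|B| <= n],
    because [(a, b) |-> a * b^-1] is injective on [A * B]; a clique number
    above [n / 3] thus forces every color to be used on exactly one vertex,
    so [n = k.+1] and the graph is complete. *)

Set Implicit Arguments.
Unset Strict Implicit.
Unset Printing Implicit Defensive.

(** The moved points split into those that [p] raises and those that it lowers in the enumeration
    order. The map [p] swaps these two sets, so the moved points are even in number. *)
Lemma odd_card_fix (T : finType) (p : T -> T) :
  involutive p -> odd #|[set x | p x == x]| = odd #|T|.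
Proof.
move=> pK; pose lt (x y : T) := enum_rank x < enum_rank y.
pose U := [set x | lt x (p x)]; pose D := [set x | lt (p x) x].
have eqUD : #|D| = #|U|.
  rewrite -(card_imset (mem U) (inv_inj pK)); apply: eq_card => x.
  apply/idP/imsetP => [|[y]]; rewrite !inE => xD; last by move=> ->; rewrite pK.
  by exists (p x); rewrite ?inE pK.
have -> : #|T| = #|[set x | p x == x]| + (#|U| + #|D|).
  rewrite -(cardC [set x | p x == x]); congr (_ + _).
  rewrite -cardsUI [U :&: D](_ : _ = set0) ?cards0 ?addn0; last first.
    by apply/setP=> x; rewrite !inE /lt; case: ltngtP.
  apply: eq_card => x; rewrite !inE /lt -(inj_eq enum_rank_inj) -val_eqE /=.
  by case: ltngtP.
by rewrite eqUD oddD addnn odd_double addbF.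
Qed.

Section RegularTotalColoring.
Variables (G : sgraph) (k : nat).
Hypothesis reg : forall x : G, degree x = k.
Variable c : {ffun element G -> 'I_k.+1}.
Hypothesis tot_c : total_coloring c.

Lemma total_coloring_neq a b : conflict a b -> c a != c b.
Proof. by move: tot_c => /forallP/(_ a)/forallP/(_ b)/implyP. Qed.

Lemma mem_edges (x y : G) : adj x y -> [set x; y] \in edges G.
Proof. by move=> xy; apply/imset2P; exists x y. Qed.

Lemma edges_card2 (E : {set G}) : E \in edges G -> #|E| = 2.
Proof.
case/imset2P=> x y _ xy ->; rewrite cards2.
by case: eqVneq xy => // ->; rewrite -topredE /= adj_irrefl.
Qed.

(* The edge [xy] when there is one, and the vertex [x] otherwise; in
   particular [elt_at x x] is the vertex [x]. *)
Definition elt_at (x y : G) : element G :=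
  if insub [set x; y] is Some E then inr E else inl x.

Lemma elt_atxx x : elt_at x x = inl x.
Proof.
rewrite /elt_at insubN //; apply/negP=> /edges_card2.
by rewrite setUid cards1.
Qed.

Lemma elt_at_adj x y (xy : adj x y) :
  elt_at x y = inr (exist _ [set x; y] (mem_edges xy)).
Proof.
rewrite /elt_at insubT ?mem_edges // => E.
by congr inr; apply: val_inj.
Qed.

Lemma elt_atC x y : adj x y -> elt_at x y = elt_at y x.
Proof.
move=> xy; have yx : adj y x by rewrite adj_sym.
by rewrite !elt_at_adj; congr inr; apply: val_inj; rewrite /= setUC.
Qed.

Definition closed_nbhd (x : G) : {set G} := x |: [set y | adj x y].

Lemma card_closed_nbhd x : #|closed_nbhd x| = k.+1.
Proof. by rewrite cardsU1 inE adj_irrefl -(reg x). Qed.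

(** As [y] ranges over the closed neighborhood, [elt_at x y] ranges over [x] and its incident edges,
    which conflict pairwise. *)
Lemma color_at_inj x : {in closed_nbhd x &, injective (fun y => c (elt_at x y))}.
Proof.
move=> y z; rewrite !inE => xy xz; apply: contra_eq => neq_yz.
apply: total_coloring_neq.
have [eq_yx|yx] := eqVneq y x; have [eq_zx|zx] := eqVneq z x.
- by rewrite eq_yx eq_zx eqxx in neq_yz.
- rewrite (negPf zx) /= in xz.
  by rewrite eq_yx elt_atxx elt_at_adj /= !inE eqxx.
- rewrite (negPf yx) /= in xy.
  by rewrite eq_zx elt_atxx elt_at_adj /= !inE eqxx.
rewrite (negPf yx) /= in xy; rewrite (negPf zx) /= in xz.
rewrite !elt_at_adj /=; apply/andP; split; last first.
  by apply/set0Pn; exists x; rewrite !inE eqxx.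
apply: contra neq_yz => /eqP/(congr1 val)/= /setP/(_ y).
by rewrite !inE eqxx orbT (negPf yx).
Qed.

(** Pigeonhole: there are [k.+1] elements at [x], as many as colors, and their colors are
    distinct. *)
Lemma color_at_surj x i : exists2 y, y \in closed_nbhd x & c (elt_at x y) = i.
Proof.
have : i \in (fun y => c (elt_at x y)) @: closed_nbhd x.
  suff -> : (fun y => c (elt_at x y)) @: closed_nbhd x = setT by rewrite inE.
  apply/eqP; rewrite eqEcard subsetT card_in_imset; last exact: color_at_inj.
  by rewrite card_closed_nbhd cardsT card_ord leqnn.
by case/imsetP=> y xy ->; exists y.
Qed.

Definition vertex_class i : {set G} := [set x | c (inl x) == i].

(** Sending each vertex to its partner along the edge of color [i], or to itself if it has color
    [i], is an involution whose fixed points form the class. *)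
Lemma odd_vertex_class i : odd #|vertex_class i| = odd #|G|.
Proof.
(* The default [x] is never reached, since every color occurs at [x]. *)
pose p x := odflt x [pick y in closed_nbhd x | c (elt_at x y) == i].
have pP x : p x \in closed_nbhd x /\ c (elt_at x (p x)) = i.
  rewrite /p; case: pickP => [y /andP[xy /eqP] //|none].
  by have [y xy cy] := color_at_surj x i; have := none y; rewrite xy cy eqxx.
have p_uniq x y : y \in closed_nbhd x -> c (elt_at x y) = i -> p x = y.
  by have [xp cp] := pP x => xy cy; apply: (@color_at_inj x); rewrite /= ?cp ?cy.
rewrite -(@odd_card_fix _ p).
  congr (odd _); apply: eq_card => x; rewrite !inE.
  apply/eqP/eqP => [cx|px]; last by have [_] := pP x; rewrite px elt_atxx.
  by apply: p_uniq; rewrite ?elt_atxx // !inE eqxx.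
move=> x; have [px|px] := eqVneq (p x) x; first by rewrite !px.
have [] := pP x; rewrite !inE (negPf px) /= => xp cp.
by apply: p_uniq; [rewrite !inE adj_sym xp orbT | rewrite -elt_atC].
Qed.

Lemma vertex_class_independent i :
  {in vertex_class i &, forall x y, ~~ adj x y}.
Proof.
move=> x y; rewrite !inE => /eqP cx /eqP cy; apply/negP=> xy.
by have := @total_coloring_neq (inl x) (inl y) xy; rewrite cx cy eqxx.
Qed.

Lemma sum_card_vertex_class : \sum_i #|vertex_class i| = #|G|.
Proof.
rewrite -sum1_card (partition_big (fun x => c (inl x)) predT) //=.
by apply: eq_bigr => i _; rewrite -sum1_card; apply: eq_bigl => x; rewrite inE.
Qed.

End RegularTotalColoring.

Section Cayley.
Variables (gT : finGroupType) (S : {set gT}).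
Hypotheses (S_inv : (S^-1)%g = S) (S_1 : 1%g \notin S).
Local Notation G := (cayley_graph S_inv S_1).

Lemma cayley_degree (x : G) : degree x = #|S|.
Proof.
rewrite /degree -(card_lcoset S x); apply: eq_card => y.
by rewrite mem_lcoset inE /= cayley_adjE.
Qed.

Lemma cayley_max_degree : max_degree G = #|S|.
Proof.
apply/eqP; rewrite eqn_leq -{2}(cayley_degree (1%g : gT)).
rewrite (@leq_bigmax G (@degree G)) andbT.
by apply/bigmax_leqP=> x _; rewrite cayley_degree.
Qed.

Lemma cayley_complete : #|G| = #|S|.+1 -> complete G.
Proof.
move=> cardG; have eqS : S = [set~ 1%g].
  apply/eqP; rewrite eqEcard cardsC1 (cardG : #|gT| = _) leqnn andbT.
  by apply/subsetP=> s; rewrite !inE; apply: contraTneq => ->.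
apply/forall_inP=> x _; apply/forall_inP=> y _; apply/implyP=> neq_xy.
by rewrite /= cayley_adjE eqS !inE -eq_mulVg1.
Qed.

Lemma cayley_clique_independent (A B : {set G}) :
  clique A -> {in B &, forall x y, ~~ adj x y} -> #|A| * #|B| <= #|G|.
Proof.
move=> cliqueA indepB; rewrite -cardsX.
pose f (u : gT * gT) := (u.1 * u.2^-1)%g.
rewrite -(@card_in_imset _ _ f) ?max_card //.
move=> [a b] [a' b'] /setXP[/= aA bB] /setXP[/= a'A b'B]; rewrite /f /= => eq_f.
(* Adjacency depends only on this quotient: if it is not the identity, [a] and [a'] are adjacent by
   the clique property, hence so are [b] and [b'], against independence. *)
have eq_quo : (a^-1 * a' = b^-1 * b')%g.
  by apply: (mulgI a); rewrite mulKVg mulgA eq_f mulgKV.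
have [eq_a|neq_a] := eqVneq a a'.
  move: eq_quo; rewrite eq_a mulVg => /esym/eqP; rewrite -eq_mulVg1.
  by move=> /eqP->.
have := indepB b b' bB b'B; rewrite /= cayley_adjE -eq_quo -cayley_adjE.
by have /forall_inP/(_ a aA)/forall_inP/(_ a' a'A)/implyP/(_ neq_a)/= -> := cliqueA.
Qed.

End Cayley.

Lemma clique_number_witness (G : sgraph) :
  exists2 A : {set G}, clique A & #|A| = clique_number G.
Proof.
have clique0 : 0 < #|[pred A : {set G} | clique A]|.
  by apply/card_gt0P; exists set0; apply/forall_inP=> x; rewrite inE.
by have [A cA eqA] := eq_bigmax_cond (fun A : {set G} => #|A|) clique0; exists A.
Qed.

Theorem theorem2p5 (gT : finGroupType) (S : {set gT})
    (S_inv : (S^-1)%g = S) (S_1 : 1%g \notin S) :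
  let G := cayley_graph S_inv S_1 in
  odd #|G| -> ~~ complete G -> #|G| < 3 * clique_number G -> ~ type_I G.
Proof.
move=> G oddG ncomplG ltG typeG.
have : total_colorable G #|S|.+1.
  rewrite -(cayley_max_degree S_inv S_1) -[_.+1]typeG.
  by rewrite /total_chromatic_number; case: ex_minnP.
case/existsP=> c tot_c; apply/negP: ncomplG; rewrite negbK.
have [A cliqueA cardA] := clique_number_witness G.
apply: cayley_complete; rewrite -(sum_card_vertex_class c).
transitivity (\sum_(i < #|S|.+1) 1); last by rewrite sum1_card card_ord.
apply: eq_bigr => i _.
have := odd_vertex_class (@cayley_degree _ _ S_inv S_1) tot_c i; rewrite oddG.
(* A class of at least three vertices, paired with a maximum clique, would give
   [3 * clique_number G <= #|G|]. Being odd and below 3, the size is then 1. *)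
have : #|vertex_class c i| < 3.
  rewrite ltnNge; apply/negP=> ge3; move: ltG; rewrite ltnNge => /negP; apply.
  apply: leq_trans (cayley_clique_independent cliqueA
                      (vertex_class_independent tot_c (i := i))).
  by rewrite cardA mulnC leq_mul2l ge3 orbT.
by case: #|_| => [|[|[|m]]].
Qed.
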